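(* Assume that for every $j$ and all $1\le \tau\le\tau'$, $\max_i p_{ji}^{(\tau)}\ge \max_i p_{ji}^{(\tau')}$, and that $R^1<\infty$ and $R^1\ge R(\vec\pi_j^{\tau},0)\ge R(\vec\pi_j^{\tau'},0)$. Let $\vec\Gamma^{-1}=\vec0$, $u^0\in\arg\max_{u\in\{1,\dots,K\}}R(\vec\pi_u^1,0)$ and $\vec\Gamma^0=\vec e_{u^0}$ (the unit vector with $1$ in position $u^0$), and for $i>0$ define recursively $$u^i\in\arg\max_{u\in\{1,\dots,K\}}R(\vec\pi_u^{\Gamma_u^{i-1}+1},0),\qquad \vec\Gamma^i=\Big(\sum_{r=0}^i\mathbf{1}_{\{u^r=1\}},\dots,\sum_{r=0}^i\mathbf{1}_{\{u^r=K\}}\Big).$$ Then Whittle's index satisfies, for all $j\ge0$, $$W\big(\vec\pi_{u^j}^{\Gamma^j_{u^j}}\big)=R^1+\sum_{k=1}^K\sum_{r=1}^{\Gamma_k^{j-1}}R(\vec\pi_k^r,0)\,\omega_k-R\big(\vec\pi_{u^j}^{\Gamma^j_{u^j}},0\big)\sum_{k=1}^K(\Gamma_k^{j-1}+1)\,\omega_k,$$ where $\omega_k=p_k^s$. Moreover, Whittle's index $W(\vec\pi_k^\tau)$ is non-decreasing in $\tau$ for every $k$.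
   Context: Single-user model. Let $K\ge1$ and let $P=(p_{ij})$ be a $K\times K$ stochastic matrix with powers $p_{ij}^{(\tau)}=(P^\tau)_{ij}$ and steady-state distribution $(p_1^s,\dots,p_K^s)$ (assumed to exist). Belief states $\vec\pi_j^\tau=\vec e_jP^\tau$, $j\in\{1,\dots,K\}$, $\tau\ge1$, are labelled by the pairs $(j,\tau)$. In each slot an action $a\in\{0,1\}$ is chosen ($1$ active, $0$ passive); the average immediate reward is $R^1$ under $a=1$ and $R(\vec\pi_j^\tau,0)\ge0$ under $a=0$. Transition law (approximating model): under $a=0$, $\vec\pi_j^\tau\to\vec\pi_j^{\tau+1}$ with probability 1; under $a=1$, $\vec\pi_j^\tau\to\vec\pi_k^1$ with probability $p_k^s$. Single-user average-reward problem with subsidy $W$: maximize the long-run expected average of the immediate reward plus $W$ for each passive slot. Whittle's index $W(\vec\pi_j^\tau)$ is the smallest value of $W$ such that an optimal policy of this problem is indifferent between the two actions in $\vec\pi_j^\tau$. $\mathbf{1}$ denotes the indicator function. *)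

(* Defs.v *)
From HB Require Import structures.
From mathcomp Require Import all_boot all_order all_algebra.
From mathcomp Require Import all_classical all_reals all_analysis.

Set Implicit Arguments.
Unset Strict Implicit.
Unset Printing Implicit Defensive.

Import Order.TTheory GRing.Theory Num.Theory.
Local Open Scope classical_set_scope.
Local Open Scope ring_scope.

Definition prob_vector (R : realType) (K : nat) (p : 'rV[R]_K) : Prop :=
  (forall i, 0 <= p 0 i) /\ \sum_i p 0 i = 1.

Definition stochastic (R : realType) (K : nat) (P : 'M[R]_K) : Prop :=
  forall j, prob_vector (row j P).

(* [passive_reward] is a function of the belief vector; the passive action earns
   the subsidy in addition to it. *)
Record user_model (R : realType) (K : nat) := UserModel {
  trans_mx : 'M[R]_K;
  steady : 'rV[R]_K;
  active_reward : R;
  passive_reward : 'rV[R]_K -> R }.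

Definition steady_state (R : realType) (K : nat) (P : 'M[R]_K) (p : 'rV[R]_K)
  : Prop := prob_vector p /\ p *m P = p.

(* The label (j, tau) of the belief e_j P^tau.  Only labels with tau >= 1 are
   states of the model: definitions below that range over states are restricted
   to [is_state]. *)
Definition state (K : nat) : Type := ('I_K * nat)%type.

Definition is_state (K : nat) (s : state K) : Prop := (0 < s.2)%N.

Definition belief (R : realType) (K : nat) (m : user_model R K) (s : state K)
  : 'rV[R]_K := delta_mx 0 s.1 *m (trans_mx m) ^+ s.2.

Definition belief_reward (R : realType) (K : nat) (m : user_model R K)
  (s : state K) : R := passive_reward m (belief m s).

(* Actions are booleans: [true] is active, [false] is passive. *)
Definition reward (R : realType) (K : nat) (m : user_model R K) (W : R)
  (s : state K) (a : bool) : R :=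
  if a then active_reward m else belief_reward m s + W.

(* Conditional expectation of [f] at the next state. *)
Definition expect_next (R : realType) (K : nat) (m : user_model R K)
  (s : state K) (a : bool) (f : state K -> R) : R :=
  if a then \sum_(k < K) steady m 0 k * f (k, 1%N) else f (s.1, s.2.+1).

(* Randomized history-dependent policies: the probability of the active action
   given the past (state, action) pairs, latest first, and the current state. *)
Definition policy (R : realType) (K : nat) : Type :=
  seq (state K * bool) -> state K -> R.

Definition is_policy (R : realType) (K : nat) (pi : policy R K) : Prop :=
  forall hist s, 0 <= pi hist s <= 1.

Definition stationary (R : realType) (K : nat) (phi : state K -> bool)
  : policy R K := fun _ s => (phi s)%:R.

Definition action_prob (R : realType) (K : nat) (pi : policy R K)
  (hist : seq (state K * bool)) (s : state K) (a : bool) : R :=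
  if a then pi hist s else 1 - pi hist s.

Fixpoint total_reward (R : realType) (K : nat) (m : user_model R K) (W : R)
  (pi : policy R K) (n : nat) (hist : seq (state K * bool)) (s : state K) : R :=
  if n is n'.+1 then
    \sum_(a : bool) action_prob pi hist s a *
      (reward m W s a
       + expect_next m s a (total_reward m W pi n' ((s, a) :: hist)))
  else 0.

Definition average_reward (R : realType) (K : nat) (m : user_model R K) (W : R)
  (pi : policy R K) (s : state K) : \bar R :=
  limn_einf (fun n => (total_reward m W pi n [::] s / n%:R)%:E).

Definition optimal (R : realType) (K : nat) (m : user_model R K) (W : R)
  (pi : policy R K) : Prop :=
  is_policy pi /\
  forall pi', is_policy pi' -> forall s, is_state s ->
    (average_reward m W pi' s <= average_reward m W pi s)%E.

Definition action_value (R : realType) (K : nat) (m : user_model R K) (W : R)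
  (h : state K -> R) (s : state K) (a : bool) : R :=
  reward m W s a + expect_next m s a h.

(* The average-reward optimality equation.  Without boundedness of the relative
   value [h] it has solutions for every large enough [g]. *)
Definition optimality_equation (R : realType) (K : nat) (m : user_model R K)
  (W g : R) (h : state K -> R) : Prop :=
  (exists C, forall s, is_state s -> `|h s| <= C) /\
  (forall s, is_state s ->
     g + h s = Num.max (action_value m W h s true) (action_value m W h s false)).

(* An optimal policy is indifferent in [s] when both actions attain the maximum
   in the optimality equation at [s].  Comparing long-run averages alone would
   not do: they do not depend on the action taken in a state that is never
   revisited. *)
Definition indifferent (R : realType) (K : nat) (m : user_model R K) (W : R)
  (s : state K) : Prop :=
  exists (phi : state K -> bool) (g : R) (h : state K -> R),
    [/\ optimal m W (stationary R phi),
        forall s', is_state s' ->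
          average_reward m W (stationary R phi) s' = g%:E,
        optimality_equation m W g h,
        forall s', is_state s' -> g + h s' = action_value m W h s' (phi s')
      & action_value m W h s true = action_value m W h s false].

(* +oo when no subsidy makes the two actions indifferent in [s]. *)
Definition whittle_index (R : realType) (K : nat) (m : user_model R K)
  (s : state K) : \bar R :=
  ereal_inf [set W%:E | W in [set W : R | indifferent m W s]].

Definition is_smallest (R : realType) (A : set R) (x : R) : Prop :=
  A x /\ forall y, A y -> x <= y.

(* Shifted by one: [Gamma u i] is the vector with exponent i - 1, so that
   [Gamma u 0] is the zero vector, and [Gamma u i.+1 k] counts the r <= i with
   u r = k. *)
Definition Gamma (K : nat) (u : nat -> 'I_K) (i : nat) (k : 'I_K) : nat :=
  (\sum_(r < i) (u r == k))%N.

(* At i = 0 this is the maximality of u 0 for the rewards of the beliefs (v, 1). *)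
Definition greedy (R : realType) (K : nat) (m : user_model R K)
  (u : nat -> 'I_K) : Prop :=
  forall i v, belief_reward m (v, (Gamma u i v).+1)
              <= belief_reward m (u i, (Gamma u i (u i)).+1).

(* Main.v *)
Require Import Defs.
From HB Require Import structures.
From mathcomp Require Import all_boot all_order all_algebra.
From mathcomp Require Import all_classical all_reals all_analysis.
From mathcomp Require Import lra.

Import Order.TTheory GRing.Theory Num.Theory.
Import numFieldNormedType.Exports.
Local Open Scope classical_set_scope.
Local Open Scope ring_scope.

(** Write [c v t] for the passive reward in state [(v, t)] and [omega] for the
    steady-state law.  In the average-reward optimality equation with subsidy
    [W] and gain [g], put [lam = g - W] and measure relative values from the
    value of acting at once.  The equation then splits into
      [x v t = max 0 (c v t - lam + x v t.+1)]   for each chain [v], and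
      [W = R1 - lam + sum_v omega_v * x v 1].
    Since [c v] is non-increasing, the least nonnegative solution of the first
    part is the excess [sum_(r >= t) max 0 (c v r - lam)], when it is finite.
    The optimal policy behind it stays passive as long as the reward is above
    [lam].

    If both actions attain the maximum in [s], then [lam = c s]: passivity
    gains [c s - lam] now, so [c s > lam] would leave a positive gain over
    acting, and [c s < lam] would have to be repaid by later rewards that are
    no larger, so that the relative value would grow linearly, against its
    boundedness ([indifferent_reward]).  Hence every subsidy making [s]
    indifferent is at least
      [critical_subsidy (c s) = R1 + sum_v omega_v * excess (c v) (c s) 1 - c s]
    ([indifferent_bound]; it can be larger, because a chain on which [c v] is
    eventually equal to [lam] admits further solutions [x]).  Conversely this
    value makes [s] indifferent as soon as the excesses are finite
    ([indifferent_critical_subsidy]): a bounded solution of the optimality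
    equation bounds the total reward of every policy over [n] slots by
    [n * g + O(1)] and is attained by the policy it selects
    ([optimality_equation_optimal]).

    So the index of [s] is [critical_subsidy (c s)], or infinite.  Raising
    [c s] keeps the excesses finite and lowers the critical subsidy; as [c k t]
    does not increase with [t], the index does not decrease
    ([whittle_index_monotone]).  For a state picked by the greedy recursion,
    the states already counted by [Gamma] have rewards at least [lam] and all
    others have rewards at most [lam]; the excess is then the
    finite sum of [c v r - lam] over [1 <= r <= Gamma v]
    ([excess_threshold]), and the critical subsidy is the stated formula. *)

(** * Excess of a reward sequence over a level *)

Definition partial_excess {R : realType} (c : nat -> R) (lam : R) (t n : nat)
  : R := \sum_(r < n) Num.max 0 (c (t + r)%N - lam).

(** Time 0 is not a state, and boundedness from time 1 yields it from any later
    time ([bounded_excess_from]). *)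
Definition bounded_excess {R : realType} (c : nat -> R) (lam : R) : Prop :=
  has_ubound (range (partial_excess c lam 1)).

Definition excess {R : realType} (c : nat -> R) (lam : R) (t : nat) : R :=
  sup (range (partial_excess c lam t)).

Definition nonincreasing_from1 {R : realType} (c : nat -> R) : Prop :=
  forall t t', (1 <= t)%N -> (t <= t')%N -> c t' <= c t.

Lemma partial_excessS {R : realType} (c : nat -> R) lam t n :
  partial_excess c lam t n.+1
  = Num.max 0 (c t - lam) + partial_excess c lam t.+1 n.
Proof.
rewrite /partial_excess big_ord_recl addn0; congr (_ + _).
by apply: eq_bigr => i _; rewrite /= /bump /= add1n addSnnS.
Qed.

Lemma partial_excess_ge0 {R : realType} (c : nat -> R) lam t n :
  0 <= partial_excess c lam t n.
Proof. by apply: sumr_ge0 => i _; rewrite le_max lexx. Qed.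

Lemma partial_excess_eq0 {R : realType} (c : nat -> R) lam t n :
  nonincreasing_from1 c -> (1 <= t)%N -> c t <= lam ->
  partial_excess c lam t n = 0.
Proof.
move=> cd t1 ct; apply: big1 => i _; apply/max_idPl.
by rewrite subr_le0 (le_trans _ ct)// cd// leq_addr.
Qed.

Lemma bounded_excess_from {R : realType} (c : nat -> R) lam t :
  bounded_excess c lam -> (1 <= t)%N ->
  has_ubound (range (partial_excess c lam t)).
Proof.
move=> bc; elim: t => // -[|t] IH _; first exact: bc.
have [C hC] := IH isT; exists C => _ [n _ <-].
have := hC _ (ex_intro2 _ _ n.+1 I erefl).
rewrite partial_excessS; apply: le_trans.
by rewrite lerDr le_max lexx.
Qed.

Lemma le_bounded_excess {R : realType} (c : nat -> R) lam lam' :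
  lam <= lam' -> bounded_excess c lam -> bounded_excess c lam'.
Proof.
move=> ll [C hC]; exists C => _ [n _ <-].
apply: le_trans (hC _ (ex_intro2 _ _ n I erefl)).
by apply: ler_sum => i _; rewrite le_max2// lerB.
Qed.

Lemma partial_excess_le {R : realType} (c : nat -> R) lam t n :
  bounded_excess c lam -> (1 <= t)%N ->
  partial_excess c lam t n <= excess c lam t.
Proof.
move=> bc t1; apply: ub_le_sup; last by exists n.
exact: bounded_excess_from.
Qed.

Lemma excess_le {R : realType} (c : nat -> R) lam t x :
  (forall n, partial_excess c lam t n <= x) -> excess c lam t <= x.
Proof.
move=> hx; apply: ge_sup.
  by exists (partial_excess c lam t 0); exists 0%N.
by move=> _ [n _ <-].
Qed.

Lemma excess_ge0 {R : realType} (c : nat -> R) lam t :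
  bounded_excess c lam -> (1 <= t)%N -> 0 <= excess c lam t.
Proof.
move=> bc t1; apply: le_trans (partial_excess_le _ _ _ 0 bc t1).
exact: partial_excess_ge0.
Qed.

Lemma le_excess {R : realType} (c : nat -> R) lam lam' t :
  lam <= lam' -> bounded_excess c lam -> (1 <= t)%N ->
  excess c lam' t <= excess c lam t.
Proof.
move=> ll bc t1; apply: excess_le => n.
apply: le_trans (partial_excess_le _ _ _ n bc t1).
by apply: ler_sum => i _; rewrite le_max2// lerB.
Qed.

(** The excess is an infinite sum, from which the first term can be split
    off; as it is encoded by a supremum, both inequalities go through the
    partial sums. *)
Lemma excess_rec {R : realType} (c : nat -> R) lam t :
  bounded_excess c lam -> (1 <= t)%N ->
  excess c lam t = Num.max 0 (c t - lam) + excess c lam t.+1.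
Proof.
move=> bc t1; apply/eqP; rewrite eq_le; apply/andP; split.
  apply: excess_le => -[|n].
    by rewrite /partial_excess big_ord0 addr_ge0 ?excess_ge0// le_max lexx.
  by rewrite partial_excessS lerD2l partial_excess_le.
rewrite -lerBrDl; apply: excess_le => n; rewrite lerBrDl -partial_excessS.
exact: partial_excess_le.
Qed.

Lemma excess_eq0 {R : realType} (c : nat -> R) lam t :
  nonincreasing_from1 c -> bounded_excess c lam -> (1 <= t)%N -> c t <= lam ->
  excess c lam t = 0.
Proof.
move=> cd bc t1 ct; apply/eqP; rewrite eq_le excess_ge0// andbT.
by apply: excess_le => n; rewrite partial_excess_eq0.
Qed.

(** This is where monotonicity enters: once the reward is below the level it
    stays there, so the positive part may be taken outside, over the whole
    continuation, instead of term by term. *)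
Lemma excess_bellman {R : realType} (c : nat -> R) lam t :
  nonincreasing_from1 c -> bounded_excess c lam -> (1 <= t)%N ->
  excess c lam t = Num.max 0 (c t - lam + excess c lam t.+1).
Proof.
move=> cd bc t1; have e0 := excess_ge0 c lam t.+1 bc isT.
have [ct|/ltW ct] := leP (c t) lam.
  have ct1 : c t.+1 <= lam by apply: le_trans ct; exact: cd.
  rewrite !excess_eq0// addr0; apply/esym/max_idPl; lra.
rewrite excess_rec//.
by rewrite (max_idPr _) ?subr_ge0// (max_idPr _)// addr_ge0// subr_ge0.
Qed.

Lemma excess_decr {R : realType} (c : nat -> R) lam t :
  bounded_excess c lam -> (1 <= t)%N -> excess c lam t <= excess c lam 1.
Proof.
move=> bc; elim: t => // -[|t] IH _ //; apply: le_trans (IH isT).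
by rewrite (excess_rec c lam t.+1)// lerDr le_max lexx.
Qed.

(** The excess is the value of optimal stopping, hence the least
    nonnegative supersolution of its Bellman equation. *)
Lemma excess_minimal {R : realType} (c x : nat -> R) lam t n :
  nonincreasing_from1 c ->
  (forall t, (1 <= t)%N -> 0 <= x t) ->
  (forall t, (1 <= t)%N -> c t - lam + x t.+1 <= x t) ->
  (1 <= t)%N -> partial_excess c lam t n <= x t.
Proof.
move=> cd x0 xs; elim: n t => [|n IH] t t1.
  by rewrite /partial_excess big_ord0 x0.
have [ct|/ltW ct] := leP (c t) lam; first by rewrite partial_excess_eq0// x0.
rewrite partial_excessS (max_idPr _) ?subr_ge0//.
by apply: le_trans (xs t t1); rewrite lerD2l IH.
Qed.

(** When the rewards cross the level at [N], the tail sums of [c r - lam] up to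
    [N] form a supersolution, so minimality gives the upper bound at once. *)
Lemma excess_threshold {R : realType} (c : nat -> R) lam N :
  nonincreasing_from1 c ->
  (forall r, (1 <= r <= N)%N -> lam <= c r) -> c N.+1 <= lam ->
  bounded_excess c lam /\ excess c lam 1 = \sum_(1 <= r < N.+1) (c r - lam).
Proof.
move=> cd hi lo; pose x t := \sum_(t <= r < N.+1) (c r - lam).
have le_x n : partial_excess c lam 1 n <= x 1%N.
  apply: excess_minimal => // t t1; rewrite /x.
    rewrite big_nat_cond; apply: sumr_ge0 => r; rewrite andbT => /andP[tr rN].
    by rewrite subr_ge0 hi// (leq_trans t1 tr).
  have [tN|Nt] := leqP t N; first by rewrite [leRHS]big_ltn.
  rewrite !big_geq//; last exact: leqW.
  rewrite addr0 subr_le0; apply: le_trans lo; exact: cd.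
have bc : bounded_excess c lam by exists (x 1%N) => _ [n _ <-].
split=> //; apply/eqP; rewrite eq_le; apply/andP; split; first exact: excess_le.
apply: le_trans (partial_excess_le c lam 1 N bc isT).
rewrite big_add1 /= big_mkord; apply: ler_sum => i _.
by rewrite le_max add1n lexx orbT.
Qed.

(** * Averages of bounded perturbations of a linear growth *)

Lemma le_limn_einf {R : realType} (u v : (\bar R)^nat) :
  (forall n, u n <= v n)%E -> (limn_einf u <= limn_einf v)%E.
Proof.
move=> uv; rewrite !limn_einf_lim; apply: lee_lim; try exact: is_cvg_einfs.
apply: nearW => n; apply: le_ereal_inf_tmp => _ [k /= nk <-].
by apply: le_trans (uv k); apply: ereal_inf_lbound; exists k.
Qed.

Lemma limn_einf_affine {R : realType} (g D : R) :
  limn_einf (fun n => ((n%:R * g + D) / n%:R)%:E) = g%:E.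
Proof.
apply: (cvg_limn_einf_sup _).1.
apply: cvg_EFin; first exact: nearW.
have sE : [sequence ((n.+1%:R * g + D) / n.+1%:R : R)]_n
        = (fun n => g + D * harmonic n) :> (nat -> R).
  by apply/funext => n /=; rewrite mulrDl mulrC mulKf.
have : [sequence ((n.+1%:R * g + D) / n.+1%:R : R)]_n @ \oo --> g.
  rewrite sE.
  rewrite -[X in _ --> X]addr0 -(mulr0 D); apply: cvgD; first exact: cvg_cst.
  by apply: cvgM; [exact: cvg_cst|exact: cvg_harmonic].
by rewrite (cvg_shiftS (fun n => (n%:R * g + D) / n%:R)).
Qed.

(** * Bounded solutions of the optimality equation *)

Section verification.
Context {R : realType} {K : nat} (m : user_model R K).
Hypothesis hsteady : prob_vector (steady m).

Lemma expect_next_shift (s : state K) a (C : R) (f : state K -> R) :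
  expect_next m s a (fun s' => C + f s') = C + expect_next m s a f.
Proof.
case: a => //=; under eq_bigr do rewrite mulrDr.
by rewrite big_split /= -mulr_suml hsteady.2 mul1r.
Qed.

Lemma expect_next_le (s : state K) a (f f' : state K -> R) :
  is_state s -> (forall s', is_state s' -> f s' <= f' s') ->
  expect_next m s a f <= expect_next m s a f'.
Proof.
move=> ss ff; case: a => /=; last exact: ff.
by apply: ler_sum => k _; rewrite ler_wpM2l ?ff//; exact: hsteady.1.
Qed.

(** Under any policy, [n * g + h s] minus the expected terminal value of [h]
    bounds the reward over [n] slots; the constant [C] absorbs that terminal
    value.  The history is carried along only because policies depend on it. *)
Lemma total_reward_upper W g (h : state K -> R) C (pi : policy R K) :
  (forall s, is_state s -> - C <= h s) ->
  (forall s a, is_state s -> action_value m W h s a <= g + h s) ->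
  is_policy pi -> forall n hist s, is_state s ->
  total_reward m W pi n hist s <= n%:R * g + C + h s.
Proof.
move=> hC hg hpi; elim=> [|n IH] hist s ss /=.
  by rewrite mul0r add0r -lerBlDl sub0r hC.
have /andP[p0 p1] := hpi hist s.
pose b a := reward m W s a
  + expect_next m s a (total_reward m W pi n ((s, a) :: hist)).
have step a : b a <= n.+1%:R * g + C + h s.
  apply: (@le_trans _ _ (n%:R * g + C + action_value m W h s a)).
    rewrite /b /action_value addrCA lerD2l -expect_next_shift.
    by apply: expect_next_le => // s' ss'; exact: IH.
  have := hg s a ss; rewrite -natr1; lra.
rewrite big_bool /=.
rewrite -/(b true) -/(b false).
have := step true; have := step false; move: (_ + h s) => x f t.
apply: (@le_trans _ _ (pi hist s * x + (1 - pi hist s) * x)); last lra.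
by rewrite lerD// ler_wpM2l// subr_ge0.
Qed.

Lemma total_reward_stationary_lower W g (h : state K -> R) C phi :
  (forall s, is_state s -> h s <= C) ->
  (forall s, is_state s -> g + h s <= action_value m W h s (phi s)) ->
  forall n hist s, is_state s ->
  n%:R * g - C + h s <= total_reward m W (stationary R phi) n hist s.
Proof.
move=> hC hg; elim=> [|n IH] hist s ss /=.
  by rewrite mul0r add0r addrC subr_le0 hC.
rewrite big_bool /= /stationary.
set b := fun a => reward m W s a
  + expect_next m s a (total_reward m W (stationary R phi) n ((s, a) :: hist)).
have -> : forall x y : R, (phi s)%:R * x + (1 - (phi s)%:R) * y
                        = if phi s then x else y.
  by move=> x y; case: (phi s); rewrite /=; lra.
suff : n.+1%:R * g - C + h s <= b (phi s) by rewrite /b; case: (phi s).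
apply: (@le_trans _ _ (n%:R * g - C + action_value m W h s (phi s))).
  have := hg s ss; rewrite -natr1; lra.
rewrite /b /action_value addrCA lerD2l -expect_next_shift.
by apply: expect_next_le => // s' ss'; exact: IH.
Qed.

(** The total reward over [n] slots is within a constant of [n * g] for the
    selected policy and at most that for every policy; dividing by [n] leaves
    [g]. *)
Lemma optimality_equation_optimal W g (h : state K -> R) phi :
  optimality_equation m W g h ->
  (forall s, is_state s -> g + h s = action_value m W h s (phi s)) ->
  optimal m W (stationary R phi) /\
  forall s, is_state s -> average_reward m W (stationary R phi) s = g%:E.
Proof.
move=> [[C hC] hopt] hphi.
have up s a : is_state s -> action_value m W h s a <= g + h s.
  by move=> ss; rewrite hopt// le_max; case: a; rewrite lexx ?orbT.
have ub pi s : is_policy pi -> is_state s ->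
    (average_reward m W pi s <= g%:E)%E.
  (* The comparison holds at n = 0 too, since both quotients are then 0. *)
  move=> hpi ss; rewrite -(limn_einf_affine g (C + h s)).
  apply: le_limn_einf => n; rewrite lee_fin ler_wpM2r ?invr_ge0//.
  rewrite addrA; apply: total_reward_upper => // s' ss'.
  by have := hC s' ss'; rewrite ler_norml => /andP[].
have lb s : is_state s ->
    (g%:E <= average_reward m W (stationary R phi) s)%E.
  move=> ss; rewrite -(limn_einf_affine g (- C + h s)).
  apply: le_limn_einf => n; rewrite lee_fin ler_wpM2r ?invr_ge0//.
  rewrite addrA; apply: total_reward_stationary_lower => // s' ss'.
    by have := hC s' ss'; rewrite ler_norml => /andP[].
  by rewrite hphi.
have pol : is_policy (stationary R phi).
  by move=> hist s; rewrite /stationary; case: (phi s); rewrite /= !lexx ler01.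
have av s : is_state s -> average_reward m W (stationary R phi) s = g%:E.
  by move=> ss; apply/eqP; rewrite eq_le ub// lb.
by split=> //; split=> // pi' hpi' s ss; rewrite av// ub.
Qed.

End verification.

(** * The index as a function of the reward of the state *)

Section index.
Context {R : realType} {K : nat} (m : user_model R K).
Hypothesis hsteady : prob_vector (steady m).
Hypothesis hR : forall v : 'I_K,
  nonincreasing_from1 (fun t => belief_reward m (v, t)).

Let c (v : 'I_K) (t : nat) : R := belief_reward m (v, t).

Definition critical_subsidy (lam : R) : R :=
  active_reward m + \sum_(v < K) steady m 0 v * excess (c v) lam 1 - lam.

Lemma le_critical_subsidy lam lam' :
  lam <= lam' -> (forall v, bounded_excess (c v) lam) ->
  critical_subsidy lam' <= critical_subsidy lam.
Proof.
move=> ll bc; rewrite /critical_subsidy lerB// lerD2l.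
apply: ler_sum => v _; rewrite ler_wpM2l ?le_excess//; exact: hsteady.1.
Qed.

(** The excess at level [c s] solves the optimality equation with gain
    [critical_subsidy (c s) + c s]; it vanishes in [s] and right after, and that
    is why both actions are optimal in [s]. *)
Lemma indifferent_critical_subsidy (s : state K) :
  is_state s ->
  (forall v, bounded_excess (c v) (belief_reward m s)) ->
  indifferent m (critical_subsidy (belief_reward m s)) s.
Proof.
case: s => v0 t0 ss; set lam := belief_reward m _ => bc.
set W := critical_subsidy lam.
pose h (s : state K) := excess (c s.1) lam s.2.
pose phi (s : state K) := belief_reward m s <= lam.
pose g := W + lam.
have av1 s : action_value m W h s true = g.
  by rewrite /action_value /= /g /W /critical_subsidy subrK.
have av0 s : action_value m W h s false
           = g + (belief_reward m s - lam + h (s.1, s.2.+1)).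
  by rewrite /action_value /= /g; lra.
have hb s : is_state s ->
    h s = Num.max 0 (belief_reward m s - lam + h (s.1, s.2.+1)).
  by case: s => v t st; rewrite /h /= excess_bellman//; exact: hR.
have opt : optimality_equation m W g h.
  split; last first.
    by move=> s st; rewrite av1 av0 hb// -{2}(addr0 g) addr_maxr.
  exists (\sum_v excess (c v) lam 1) => -[v t] st.
  rewrite ger0_norm /h /=; last exact: excess_ge0.
  rewrite (bigD1 v)//= (le_trans (excess_decr _ _ _ (bc v) st))// lerDl.
  by apply: sumr_ge0 => v' _; exact: excess_ge0.
have h0 s : is_state s -> belief_reward m s <= lam -> h s = 0.
  by case: s => v t st ct; rewrite /h /= excess_eq0//; exact: hR.
have greedy_phi s : is_state s -> g + h s = action_value m W h s (phi s).
  rewrite /phi => st; have [ct|/ltW ct] := leP (belief_reward m s) lam.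
    by rewrite av1 h0// addr0.
  rewrite av0 hb// (max_idPr _)// addr_ge0 ?subr_ge0// /h excess_ge0//.
have [phi_opt phi_avg]
  := optimality_equation_optimal m hsteady W g h phi opt greedy_phi.
exists phi, g, h; split=> //.
rewrite av1 av0 h0// ?addr0 ?subrr ?addr0//.
by rewrite /lam; apply: hR.
Qed.

(** Indifference makes the next state worth [lam - c s] more than acting at
    once, where [lam = g - W]; this is nonnegative.  If it were positive, remaining
    passive would be forced in the next state, whose reward is no larger, so
    that the surplus increases by at least the same amount at every step, which
    no bounded relative value allows. *)
Lemma indifferent_reward W (s : state K) (g : R) (h : state K -> R) :
  is_state s -> optimality_equation m W g h ->
  action_value m W h s true = action_value m W h s false ->
  g - W = belief_reward m s.
Proof.
case: s => v t st [[C hC] hopt] eqa.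
set H := action_value m W h (v, t) true in eqa.
(* [H - g] is the relative value of any state in which acting is optimal. *)
pose y n := h (v, (t + n)%N) - (H - g).
have y0 n : 0 <= y n.
  rewrite /y subr_ge0 lerBlDl hopt; last by rewrite /is_state /= ltn_addr.
  by rewrite le_max lexx.
have yS n : 0 < y n -> y n.+1 = y n + (g - W - c v (t + n)).
  rewrite /y subr_gt0 ltrBlDl hopt; last by rewrite /is_state /= ltn_addr.
  have := hopt (v, (t + n)%N).
  rewrite -/H lt_max ltxx /= => + hlt; rewrite (max_idPr _) ?ltW//.
  move=> /(_ (ltn_addr _ st)); rewrite /action_value /= addnS -/(c v _).
  move=> E; lra.
set d := g - W - c v t.
have y1 : y 1%N = d.
  have : g + h (v, t) = H by rewrite hopt// -eqa maxxx.
  move: eqa; rewrite /y {1}/action_value /= -/(c v t) addn1 /d => -> E; lra.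
have := y0 1%N; rewrite y1 le_eqVlt => /orP[/eqP d0|dgt0].
  by apply/eqP; rewrite -subr_eq0 -/(c v t) -/d -d0.
have grow n : n.+1%:R * d <= y n.+1.
  elim: n => [|n IH]; first by rewrite mul1r y1.
  rewrite yS; last by apply: lt_le_trans IH; rewrite mulr_gt0.
  have : c v (t + n.+1) <= c v t by apply: hR => //; rewrite leq_addr.
  move: IH; rewrite /d -[in X in _ -> _ -> X <= _]natr1; lra.
pose B := (C - (H - g)) / d.
have [k /= kB] : exists k, B < k.+1%:R.
  exists (Num.truncn B); exact: truncnS_gt.
have := grow k; have := hC (v, (t + k.+1)%N) (ltn_addr _ st).
rewrite ler_norml => /andP[_]; rewrite /y => h1 h2.
move: kB; rewrite /B ltr_pdivrMr// => h3; lra.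
Qed.

(** The relative values, measured from the value of acting, are nonnegative
    supersolutions for the level [g - W = c s], so they dominate the
    excess; averaging over the steady state recovers [W]. *)
Lemma indifferent_bound W (s : state K) :
  is_state s -> indifferent m W s ->
  (forall v, bounded_excess (c v) (belief_reward m s)) /\
  critical_subsidy (belief_reward m s) <= W.
Proof.
move=> st [_ [g [h [_ _ opt _ eqa]]]].
rewrite -(indifferent_reward _ _ _ _ st opt eqa).
case: opt => [_ hopt]; set H := \sum_(v < K) steady m 0 v * h (v, 1%N).
pose x v t := h (v, t) - (active_reward m + H - g).
have le_x v t n : (1 <= t)%N -> partial_excess (c v) (g - W) t n <= x v t.
  move=> t1; apply: excess_minimal t1; first exact: hR.
    move=> {}t t1; rewrite /x subr_ge0 lerBlDl hopt//.
    by rewrite le_max /action_value /= lexx.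
  move=> {}t t1; have := hopt (v, t) t1 => E.
  have : action_value m W h (v, t) false <= g + h (v, t).
    by rewrite E le_max lexx orbT.
  rewrite /action_value /= -/(c v t) /x; lra.
split=> [v|]; first by exists (x v 1%N) => _ [n _ <-]; exact: le_x.
have : \sum_(v < K) steady m 0 v * excess (c v) (g - W) 1
       <= \sum_(v < K) steady m 0 v * x v 1%N.
  apply: ler_sum => v _; rewrite ler_wpM2l//; first exact: hsteady.1.
  by apply: excess_le => n; exact: le_x.
under [leRHS]eq_bigr do rewrite mulrBr.
rewrite sumrB -mulr_suml hsteady.2 mul1r -/H /critical_subsidy; lra.
Qed.

Lemma smallest_indifferent (s : state K) :
  is_state s -> (forall v, bounded_excess (c v) (belief_reward m s)) ->
  is_smallest [set W : R | indifferent m W s]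
    (critical_subsidy (belief_reward m s)).
Proof.
move=> st bc; split; first exact: indifferent_critical_subsidy.
by move=> W /(indifferent_bound _ _ st)[].
Qed.

(** Comparing the sets of indifferent subsidies rather than the indices also
    covers the states whose index is infinite. *)
Lemma whittle_index_monotone (s s' : state K) :
  is_state s -> is_state s' -> belief_reward m s' <= belief_reward m s ->
  (whittle_index m s <= whittle_index m s')%E.
Proof.
move=> st st' le_c; apply: le_ereal_inf_tmp => _ [W hW <-].
have [bc' le_W] := indifferent_bound _ _ st' hW.
have bc v : bounded_excess (c v) (belief_reward m s).
  exact: le_bounded_excess (bc' v).
apply: (@le_trans _ _ (critical_subsidy (belief_reward m s))%:E).
  apply: ereal_inf_lbound; exists (critical_subsidy (belief_reward m s)) => //.
  exact: indifferent_critical_subsidy.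
by rewrite lee_fin (le_trans _ le_W)// le_critical_subsidy.
Qed.

End index.

Lemma is_smallest_ereal_inf {R : realType} (A : set R) (x : R) :
  is_smallest A x -> ereal_inf [set y%:E | y in A] = x%:E.
Proof.
move=> [Ax lbx]; apply/eqP; rewrite eq_le; apply/andP; split.
  by apply: ereal_inf_lbound; exists x.
by apply: le_ereal_inf_tmp => _ [y Ay <-]; rewrite lee_fin lbx.
Qed.

(** * The greedy enumeration of states *)

Lemma GammaS {K : nat} (u : nat -> 'I_K) i k :
  Gamma u i.+1 k = (Gamma u i k + (u i == k))%N.
Proof. by rewrite /Gamma big_ord_recr. Qed.

Section greedy.
Context {R : realType} {K : nat} (m : user_model R K) (u : nat -> 'I_K).
Hypothesis hR : forall v : 'I_K,
  nonincreasing_from1 (fun t => belief_reward m (v, t)).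
Hypothesis hu : greedy m u.

Let picked i := belief_reward m (u i, (Gamma u i (u i)).+1).

Lemma picked_nonincreasing i : picked i.+1 <= picked i.
Proof.
apply: le_trans (hu i (u i.+1)); apply: hR => //.
by rewrite ltnS GammaS leq_addr.
Qed.

(** A state counted by [Gamma u j] was picked before stage [j], and the rewards
    of picked states never increase. *)
Lemma picked_le_counted j v r :
  (1 <= r <= Gamma u j v)%N -> picked j <= belief_reward m (v, r).
Proof.
elim: j => [|j IH].
  by rewrite /Gamma big_ord0 leqn0 => /andP[+ /eqP r0]; rewrite r0.
move=> /andP[r1]; rewrite GammaS => rG.
apply: le_trans (picked_nonincreasing j) _.
have [rG'|rG'] := leqP r (Gamma u j v); first by rewrite IH// r1.
case: eqVneq rG => [uv|_] rG; last by rewrite addn0 leqNgt rG' in rG.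
have -> : r = (Gamma u j v).+1 by apply/eqP; rewrite eqn_leq rG' andbT -addn1.
by rewrite /picked uv.
Qed.

End greedy.

(** * The index formula *)

Theorem corollary1 (R : realType) (K : nat) (hK : (1 <= K)%N)
  (m : user_model R K)
  (hP : stochastic (trans_mx m))
  (hsteady : steady_state (trans_mx m) (steady m))
  (hR0 : forall s : state K, is_state s -> 0 <= belief_reward m s)
  (hmax : forall (j : 'I_K) (t t' : nat), (1 <= t)%N -> (t <= t')%N ->
     \big[Num.max/0]_(i < K) ((trans_mx m) ^+ t') j i
     <= \big[Num.max/0]_(i < K) ((trans_mx m) ^+ t) j i)
  (hR1 : forall (j : 'I_K) (t : nat), (1 <= t)%N ->
     belief_reward m (j, t) <= active_reward m)
  (hR : forall (j : 'I_K) (t t' : nat), (1 <= t)%N -> (t <= t')%N ->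
     belief_reward m (j, t') <= belief_reward m (j, t))
  (u : nat -> 'I_K) (hu : greedy m u) :
  (forall j : nat,
     let s : state K := (u j, Gamma u j.+1 (u j)) in
     let w : R :=
       active_reward m
       + \sum_(k < K) \sum_(1 <= r < (Gamma u j k).+1)
           belief_reward m (k, r) * steady m 0 k
       - belief_reward m s * \sum_(k < K) ((Gamma u j k).+1)%:R * steady m 0 k in
     is_smallest [set W : R | indifferent m W s] w /\ whittle_index m s = w%:E)
  /\
  (forall (k : 'I_K) (t t' : nat), (1 <= t)%N -> (t <= t')%N ->
     (whittle_index m (k, t) <= whittle_index m (k, t'))%E).
Proof.
have [hpv _] := hsteady.
split; last first.
  move=> k t t' t1 tt'; apply: whittle_index_monotone => //; last exact: hR.
  exact: leq_trans tt'.
move=> j s w.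
have sE : s = (u j, (Gamma u j (u j)).+1) by rewrite /s GammaS eqxx addn1.
pose lam := belief_reward m s.
have ex v : bounded_excess (fun t => belief_reward m (v, t)) lam /\
    excess (fun t => belief_reward m (v, t)) lam 1
    = \sum_(1 <= r < (Gamma u j v).+1) (belief_reward m (v, r) - lam).
  apply: excess_threshold; first exact: hR.
    by move=> r hr; rewrite /lam sE; exact: picked_le_counted hr.
  by rewrite /lam sE; exact: hu.
have lamE : lam = \sum_v lam * steady m 0 v by rewrite -mulr_sumr hpv.2 mulr1.
have -> : w = critical_subsidy m lam.
  rewrite /w /critical_subsidy -/lam -!addrA; congr (_ + _).
  rewrite mulr_sumr -sumrB [X in _ = _ - X]lamE -sumrB.
  apply: eq_bigr => v _; rewrite (ex v).2 sumrB -mulr_suml big_const_nat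
    iter_addr_0.
  by rewrite subSS subn0 -[lam *+ _]mulr_natr -natr1; lra.
have sm : is_smallest [set W | indifferent m W s] (critical_subsidy m lam).
  apply: smallest_indifferent => //; first by rewrite sE.
  by move=> v; exact: (ex v).1.
by split=> //; exact: is_smallest_ereal_inf.
Qed.
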